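(* Let $\mathcal{X}$ be an instance of the resource sharing problem with an exact block solver ($\sigma=1$) that has a product structure with respect to a partition $\mathcal{R}=\mathcal{R}_1\cup\dots\cup\mathcal{R}_k$ (as described in the context); the partition need not be known to the algorithm. Then there is an algorithm which, for every $\delta\in(0,1]$, computes a solution $x\in\mathcal{X}$ satisfying \[\max_{r\in\mathcal{R}_i}x_r\le\min_{x_i\in\mathcal{X}_i}\|x_i\|_\infty+\delta\lambda^*\qquad\text{for all } i=1,\dots,k,\] using $\mathcal{O}\!\left(\frac{n+m}{\delta^2}\log m\right)$ oracle calls.
   Context: Resource sharing problem: finite sets $\mathcal{C}$ (customers) and $\mathcal{R}$ (resources), $n=|\mathcal{C}|$, $m=|\mathcal{R}|$; for each $C$ a nonempty closed convex $X_C\subseteq\mathbb{R}^{\mathcal{R}}_{\ge0}$; $\mathcal{X}=\sum_CX_C$ (Minkowski sum); oracles $f_C:\mathbb{R}^m_{\ge0}\to X_C$ with $\langle y,f_C(y)\rangle\le\sigma\min_{x\in X_C}\langle y,x\rangle$ ($\sigma=1$: exact), an evaluation of some $f_C$ being an oracle call; $\lambda^*=\min_{x\in\mathcal{X}}\|x\|_\infty$. Product structure: $\mathcal{R}=\mathcal{R}_1\cup\dots\cup\mathcal{R}_k$ is a partition and each $X_C=X^{(C)}_1\times\dots\times X^{(C)}_k$ with $X^{(C)}_i\subseteq\mathbb{R}^{\mathcal{R}_i}_{\ge0}$; $\mathcal{X}_i:=\sum_CX^{(C)}_i$, so $\mathcal{X}=\mathcal{X}_1\times\dots\times\mathcal{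X}_k$.
   Formalization: The factor log m in the bound on oracle calls is read as log(max(m,2)), since for m = 1 the literal bound would allow no oracle call at all, and no algorithm could then find a solution; for m ≥ 2 the bound is unchanged. *)

(* Defs.v *)
From HB Require Import structures.
From mathcomp Require Export all_boot all_order all_algebra.
From mathcomp Require Export all_classical all_reals all_analysis.

Set Implicit Arguments.
Unset Strict Implicit.
Unset Printing Implicit Defensive.

Import Order.TTheory GRing.Theory Num.Theory.
Import numFieldNormedType.Exports.

Local Open Scope classical_set_scope.
Local Open Scope ring_scope.

(* All minima below are attained: norms are minimized over closed sets (a finite
   sum of closed subsets of the nonnegative orthant is closed), and an exact
   block solver attains the minima of the linear functionals. *)
Definition minimum (R : realType) (T : Type) (A : set T) (g : T -> R) : R :=
  inf [set g x | x in A].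

Definition minkowski_sum (V : zmodType) (n : nat) (X : 'I_n -> set V) : set V :=
  [set \sum_C x C | x in [set x : 'I_n -> V | forall C, X C (x C)]].

Definition nonneg_vec (R : realType) (m : nat) : set 'rV[R]_m :=
  [set x | forall r, 0 <= x 0 r].

(* The customers are 'I_n and the resources are 'I_m. *)
Definition resource_sharing (R : realType) (n m : nat)
    (X : 'I_n -> set 'rV[R]_m) : Prop :=
  forall C, [/\ X C !=set0, closed (X C), convex_set (X C)
              & X C `<=` @nonneg_vec R m].

Definition price (R : realType) (m : nat) : Type := 'rV[{nonneg R}]_m.

Definition cost (R : realType) (m : nat) (y : price R m) (x : 'rV[R]_m) : R :=
  \sum_r (y 0 r)%:num * x 0 r.

Definition block_solver (R : realType) (sigma : R) (n m : nat)
    (X : 'I_n -> set 'rV[R]_m) (f : 'I_n -> price R m -> 'rV[R]_m) : Prop :=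
  forall C y, X C (f C y) /\ cost y (f C y) <= sigma * minimum (X C) (cost y).

(* The norm of 'rV[R]_m in the library is the maximum norm. *)
Definition lambda_star (R : realType) (n m : nat)
    (X : 'I_n -> set 'rV[R]_m) : R :=
  minimum (minkowski_sum X) (fun x => `|x|).

(* R^B for a set B of resources is 'rV[R]_#|B|, the coordinates being listed in
   the order of enum B. *)
Definition restrict (R : realType) (m : nat) (B : {set 'I_m}) (x : 'rV[R]_m) :
  'rV[R]_#|B| := \row_j x 0 (enum_val j).

(* Y C B is the factor of X C in R^B; only the blocks B of the partition P
   matter. *)
Definition product_structure (R : realType) (n m : nat)
    (X : 'I_n -> set 'rV[R]_m) (P : {set {set 'I_m}})
    (Y : 'I_n -> forall B : {set 'I_m}, set 'rV[R]_#|B|) : Prop :=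
  [/\ finset.partition P [set: 'I_m]%SET,
      forall C B, B \in P -> Y C B `<=` @nonneg_vec R #|B|
    & forall C, X C = [set x | forall B, B \in P -> Y C B (restrict B x)]].

(* A deterministic adaptive algorithm with oracle access: it either outputs a
   vector, or evaluates f C at y and continues according to the answer. Only the
   oracle calls are counted; it learns about the instance only through them. *)
Inductive oracle_algorithm (R : realType) (n m : nat) : Type :=
| Output of 'rV[R]_m
| Call (C : 'I_n) (y : price R m) of 'rV[R]_m -> oracle_algorithm R n m.

Fixpoint output (R : realType) (n m : nat)
    (f : 'I_n -> price R m -> 'rV[R]_m) (a : oracle_algorithm R n m) :
    'rV[R]_m :=
  match a with
  | Output x => x
  | Call C y k => output f (k (f C y))
  end.

Fixpoint oracle_calls (R : realType) (n m : nat)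
    (f : 'I_n -> price R m -> 'rV[R]_m) (a : oracle_algorithm R n m) : nat :=
  match a with
  | Output _ => 0%N
  | Call C y k => (oracle_calls f (k (f C y))).+1
  end.

(* Main.v *)
Require Import Defs.
From HB Require Import structures.
From mathcomp Require Import all_boot all_order all_algebra.
From mathcomp Require Import all_classical all_reals all_analysis.
From mathcomp Require Import ring lra.

Set Implicit Arguments.
Unset Strict Implicit.
Unset Printing Implicit Defensive.

Import Order.TTheory GRing.Theory Num.Theory.
Import numFieldNormedType.Exports.

Local Open Scope classical_set_scope.
Local Open Scope ring_scope.

(** Multiplicative weights with prices y_r = exp (eta * x_r), where x is the
    accumulated resource usage. In each phase every customer receives one unit of
    its oracle's answers, in portions that raise no coordinate by more than c.

    An exact oracle is optimal on every block B separately, so the potential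
    Phi_B = sum_(r in B) exp (eta * x_r) obeys, over one phase,
    Phi_B' <= Phi_B + eta * (1 + 2 * eta * c) * lambda_B * Phi_B' (prices only
    increase, hence may be taken at the end of the phase). After p phases
    x_r / p <= ln m / (eta * p) + (1 + O(eta * c)) * lambda_B for all r in B,
    which is the claim when c is of the order of lambda*, eta * c of the order of
    delta, and p of the order of ln m / delta ^ 2. A call that does not complete a
    customer's unit raises some coordinate by c, and by Jensen's inequality the
    sum of all eta * x_r is at most m * ln (Phi / m); this yields O(p * (n + m))
    calls.

    The scale c is found as follows. Unit prices give l <= lambda* <= m * l. A run
    of p phases at scale 2 * l with a bounded number of calls certifies either
    lambda* >= 2 * l or lambda* = O(l * (1 + ln m / p)); doubling p whenever the
    gap has been halved, O(log m) phases in total determine lambda* up to a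
    constant factor. *)

(** * Coordinates and the maximum norm of row vectors *)

Section RowNorm.
Variables (R : realType) (m : nat).
Implicit Types x : 'rV[R]_m.

Lemma ler_coord_norm x r : x 0 r <= `|x|.
Proof.
apply: le_trans (ler_norm _) _.
by rewrite [leRHS]/Num.norm /= mx_normrE; apply/bigmax_geP; right; exists (0, r).
Qed.

Lemma rV_norm_le x M : 0 <= M -> (forall r, `|x 0 r| <= M) -> `|x| <= M.
Proof.
move=> M0 xM; rewrite [leLHS]/Num.norm /= mx_normrE; apply: bigmax_le => //.
by move=> [i r] _ /=; rewrite ord1.
Qed.

Lemma rV_norm_attained x : `|x| != 0 -> exists r, `|x| = `|x 0 r|.
Proof. by move=> /mx_norm_neq0[[i r] /= e]; exists r; rewrite -(ord1 i). Qed.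

End RowNorm.

(** * Elementary inequalities for the exponential *)

Section Exponential.
Variable R : realType.

(** From [1 - u <= expR (- u)] one gets [expR u <= 1 / (1 - u)]; the factor [1 + 2 * theta] absorbs
    the rest because [u <= theta <= 1/2]. *)
Lemma expR_le_linear (theta u : R) :
  theta <= 2^-1 -> 0 <= u <= theta -> expR u <= 1 + (1 + 2 * theta) * u.
Proof.
move=> th2 /andP[u0 uth].
have := expR_ge1Dx (- u); rewrite expRN => eu.
have u1 : 0 < 1 - u by lra.
have : expR u <= (1 - u)^-1 by rewrite -[leLHS]invrK lef_pV2 ?posrE ?invr_gt0 ?expR_gt0.
move=> /le_trans; apply; rewrite -div1r ler_pdivrMr//; nra.
Qed.

Lemma inv1B_le_expR (z : R) : z < 1 -> (1 - z)^-1 <= expR (z / (1 - z)).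
Proof.
move=> z1; apply: le_trans (expR_ge1Dx _).
have z0 : 1 - z != 0 by lra.
by rewrite le_eqVlt; apply/orP; left; apply/eqP; field.
Qed.

(** Jensen's inequality, obtained by summing the tangent bound [1 + (u r - a) <= expR (u r - a)]. *)
Lemma sum_le_of_sum_expR (m : nat) (u : 'I_m -> R) (a : R) :
  \sum_r expR (u r) <= m%:R * expR a -> \sum_r u r <= m%:R * a.
Proof.
move=> sum_exp.
have : \sum_r (1 + (u r - a)) <= \sum_r expR (u r - a).
  by apply: ler_sum => r _; exact: expR_ge1Dx.
have -> : \sum_r expR (u r - a) = (\sum_r expR (u r)) / expR a.
  by rewrite mulr_suml; apply: eq_bigr => r _; rewrite expRD expRN.
rewrite !big_split/= !sumr_const card_ord.
have : (\sum_r expR (u r)) / expR a <= m%:R by rewrite ler_pdivrMr ?expR_gt0.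
rewrite -(mulr_natl (- a)); lra.
Qed.

End Exponential.

(** Portions from one convex set merge into a multiple of their weighted mean; total weight 0 has no
    mean and is treated apart. *)
Lemma convex_cone_add (R : realType) (V : lmodType R) (X : set V) (a b : R) u v :
  convex_set X -> 0 <= a -> 0 <= b -> X u -> X v ->
  exists2 w, X w & a *: u + b *: v = (a + b) *: w.
Proof.
move=> cX a0 b0 Xu Xv; have [ab0|ab0] := eqVneq (a + b) 0.
  exists u => //; have a00 : a = 0 by lra.
  have b00 : b = 0 by lra.
  by rewrite a00 b00 addr0 !scale0r addr0.
have abp : 0 < a + b by rewrite lt_neqAle eq_sym ab0 addr_ge0.
have k0 : 0 <= a / (a + b) by rewrite divr_ge0// ltW.
have k1 : a / (a + b) <= 1 by rewrite ler_pdivrMr// mul1r lerDl.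
have /set_mem Xw := cX u v (Itv01 k0 k1) (mem_set Xu) (mem_set Xv).
exists (a / (a + b) *: u + (1 - a / (a + b)) *: v); first exact: Xw.
by rewrite scalerDr !scalerA mulrBr mulr1 mulrC divfK// addrAC subrr add0r.
Qed.

(** * Oracle programs as a monad, with their call counts *)

Section Programs.
Variables (R : realType) (n m : nat).

(** [oracle_algorithm] with an arbitrary return type, so that subroutines compose by [bind]. *)
Inductive prog (A : Type) : Type :=
| Ret of A
| Ask (C : 'I_n) (y : price R m) of 'rV[R]_m -> prog A.

Fixpoint bind (A B : Type) (p : prog A) (k : A -> prog B) : prog B :=
  match p with
  | Ret a => k a
  | Ask C y h => Ask C y (fun b => bind (h b) k)
  end.

Fixpoint algorithm_of (p : prog 'rV[R]_m) : oracle_algorithm R n m :=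
  match p with
  | Ret x => Output n x
  | Ask C y h => Call C y (fun b => algorithm_of (h b))
  end.

Variable f : 'I_n -> price R m -> 'rV[R]_m.

Fixpoint result (A : Type) (p : prog A) : A :=
  match p with Ret a => a | Ask C y h => result (h (f C y)) end.

Fixpoint calls (A : Type) (p : prog A) : nat :=
  match p with Ret _ => 0%N | Ask C y h => (calls (h (f C y))).+1 end.

Lemma result_bind A B (p : prog A) (k : A -> prog B) :
  result (bind p k) = result (k (result p)).
Proof. by elim: p => //= C y h IH; exact: IH. Qed.

Lemma calls_bind A B (p : prog A) (k : A -> prog B) :
  calls (bind p k) = (calls p + calls (k (result p)))%N.
Proof. by elim: p => //= C y h IH; rewrite IH addSn. Qed.

Lemma output_algorithm_of p : output f (algorithm_of p) = result p.
Proof. by elim: p => //= C y h IH; exact: IH. Qed.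

Lemma oracle_calls_algorithm_of p : oracle_calls f (algorithm_of p) = calls p.
Proof. by elim: p => //= C y h IH; rewrite IH. Qed.

End Programs.
Arguments Ret {R n m A}.
Arguments Ask {R n m A}.

(** * Phases of multiplicative weights: call balance, feasibility, monotonicity *)

Section MultiplicativeWeights.
Variables (R : realType) (n m : nat) (eta c : R).
Implicit Types (w : R) (x b : 'rV[R]_m) (ts : seq 'I_n) (B : {set 'I_m}).

Definition exp_price x : price R m :=
  \row_r NngNum (expR_ge0 (eta * x 0 r)).

Definition step_size (w : R) b : R := if w * `|b| <= c then w else c / `|b|.

Definition next_tasks C ts (w : R) b : seq 'I_n * R :=
  if w * `|b| <= c then (ts, 1) else (C :: ts, w - c / `|b|).

(* Serves the customers in [ts] by one unit each, except for the first one, of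
   which only [w] units are left. No call changes a coordinate by more than [c].
   Returns the unused part of [fuel], or None if it does not suffice. *)
Fixpoint serve (fuel : nat) ts (w : R) x {struct fuel} :
    prog R n m (option nat * 'rV[R]_m) :=
  match ts, fuel with
  | [::], _ => Ret (Some fuel, x)
  | _, 0%N => Ret (None, x)
  | C :: ts', fuel'.+1 =>
      Ask C (exp_price x) (fun b =>
        let: (ts1, w1) := next_tasks C ts' w b in
        serve fuel' ts1 w1 (x + step_size w b *: b))
  end.

Fixpoint phases (p fuel : nat) x : prog R n m (option nat * 'rV[R]_m) :=
  match p with
  | 0%N => Ret (Some fuel, x)
  | p'.+1 => bind (serve fuel (enum 'I_n) 1 x) (fun s =>
      match s.1 with
      | Some fuel' => phases p' fuel' s.2
      | None => Ret s
      end)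
  end.

(** The demand of [C] still open in a state of [serve]; the invariants weight the customers by
    it. *)
Definition remaining ts (w : R) (C : 'I_n) : R :=
  if ts is C0 :: ts' then (C0 == C)%:R * w + (count_mem C ts')%:R else 0.
Arguments remaining : simpl never.

Definition potential B x : R := \sum_(r in B) expR (eta * x 0 r).

Hypotheses (eta_gt0 : 0 < eta) (c_gt0 : 0 < c).

Lemma step_size_ge0 w b : 0 <= w -> 0 <= step_size w b.
Proof. by rewrite /step_size; case: ifP => // _ _; rewrite divr_ge0// ltW. Qed.

Lemma step_size_norm_le w b : step_size w b * `|b| <= c.
Proof.
rewrite /step_size; case: ifP => // _.
have [->|b0] := eqVneq `|b| 0; first by rewrite mulr0 ltW.
by rewrite divfK.
Qed.

Lemma next_tasks_ge0 C ts w b : 0 <= (next_tasks C ts w b).2.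
Proof.
rewrite /next_tasks; case: ifPn => //=; rewrite -ltNge => cwb.
have b0 : 0 < `|b|.
  rewrite lt_neqAle normr_ge0 andbT eq_sym; apply: contraTneq cwb => ->.
  by rewrite mulr0 -leNgt ltW.
by rewrite subr_ge0 ler_pdivrMr// ltW.
Qed.

Lemma remaining_ge0 ts w C : 0 <= w -> 0 <= remaining ts w C.
Proof. by case: ts => //= C0 ts w0; rewrite /remaining addr_ge0// mulr_ge0. Qed.

Lemma remaining1 ts C : remaining ts 1 C = (count_mem C ts)%:R.
Proof. by case: ts => //= C0 ts; rewrite /remaining mulr1 natrD. Qed.

(** Conservation of demand: a call moves exactly its portion from open to served. *)
Lemma remaining_next C ts w b C' :
  remaining (C :: ts) w C' =
  remaining (next_tasks C ts w b).1 (next_tasks C ts w b).2 C' +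
  (C == C')%:R * step_size w b.
Proof.
rewrite /next_tasks /step_size; case: ifP => _; first by rewrite /= remaining1 addrC.
by rewrite /remaining/=; ring.
Qed.

Variable f : 'I_n -> price R m -> 'rV[R]_m.

Lemma calls_serve fuel ts w x :
  (calls f (serve fuel ts w x) +
   odflt 0 (result f (serve fuel ts w x)).1 = fuel)%N.
Proof.
elim: fuel ts w x => [|fuel IH] [|C ts] w x //=.
by case: next_tasks => ts1 w1; rewrite addSn IH.
Qed.

Lemma calls_phases p fuel x :
  (calls f (phases p fuel x) +
   odflt 0 (result f (phases p fuel x)).1 = fuel)%N.
Proof.
elim: p fuel x => [|p IH] fuel x //=; rewrite calls_bind result_bind.
have := calls_serve fuel (enum 'I_n) 1 x.
case: (result f (serve _ _ _ _)) => -[fuel'|] x' /= e; last by rewrite addn0.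
by rewrite -addnA IH.
Qed.

(** By induction the later portions of each customer form a multiple of one point; [convex_cone_add]
    merges the present answer into it. *)
Lemma serve_feasible (X : 'I_n -> set 'rV[R]_m) fuel ts w x fuel' x' :
  (forall C, convex_set (X C)) -> (forall C y, X C (f C y)) -> 0 <= w ->
  result f (serve fuel ts w x) = (Some fuel', x') ->
  exists2 u : 'I_n -> 'rV[R]_m, forall C, X C (u C) &
    x' = x + \sum_C remaining ts w C *: u C.
Proof.
move=> cX Xf; elim: fuel ts w x => [|fuel IH] [|C ts] w x w0 //=.
(* No demand is open, so all weights vanish and any points of the sets serve as [u]. *)
- move=> [_ <-]; exists (fun C => f C (exp_price 0)) => //.
  by rewrite big1 ?addr0// => C _; rewrite scale0r.
- move=> [_ <-]; exists (fun C => f C (exp_price 0)) => //.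
  by rewrite big1 ?addr0// => C _; rewrite scale0r.
set b := f C _; have := next_tasks_ge0 C ts w b.
have := remaining_next C ts w b.
case: next_tasks => ts1 w1 /= rem w10 /(IH _ _ _ w10)[u Xu ->].
have [v Xv ve] := convex_cone_add (cX C) (remaining_ge0 ts1 C w10)
  (step_size_ge0 b w0) (Xu C) (Xf C (exp_price x)).
exists (fun C' => if C' == C then v else u C').
  by move=> C'; case: eqP => [->|].
rewrite -addrA; congr (_ + _).
rewrite (bigD1 C)//= [in RHS](bigD1 C)//= addrA [_ *: b + _]addrC ve eqxx rem eqxx mul1r.
congr (_ + _); apply: eq_bigr => C' C'C.
by rewrite (negbTE C'C) rem eq_sym (negbTE C'C) mul0r addr0.
Qed.

Lemma phases_feasible (X : 'I_n -> set 'rV[R]_m) p fuel x fuel' x' :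
  (forall C, convex_set (X C)) -> (forall C y, X C (f C y)) ->
  result f (phases p fuel x) = (Some fuel', x') ->
  exists2 u : 'I_n -> 'rV[R]_m, forall C, X C (u C) &
    x' = x + p%:R *: \sum_C u C.
Proof.
move=> cX Xf; elim: p fuel x => [|p IH] fuel x /=.
  move=> [_ <-]; exists (fun C => f C (exp_price 0)) => //.
  by rewrite scale0r addr0.
rewrite result_bind; case e: (result f (serve _ _ _ _)) => [[fuel1|] x1] //=.
have [u Xu ->] := serve_feasible cX Xf ler01 e.
move=> /IH[v Xv ->].
have /choice[q Xq] C : exists q, X C q /\ u C + p%:R *: v C = p.+1%:R *: q.
  have [q Xq qe] := convex_cone_add (cX C) ler01 (ler0n R p) (Xu C) (Xv C).
  by exists q; split=> //; rewrite -natr1 [p%:R + 1]addrC -qe scale1r.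
exists q; first by move=> C; have [] := Xq C.
rewrite -addrA; congr (_ + _); rewrite !scaler_sumr -big_split/=.
apply: eq_bigr => C _; have [_ <-] := Xq C.
by rewrite remaining1 count_uniq_mem ?enum_uniq// mem_enum scale1r.
Qed.

Hypothesis f_ge0 : forall C y r, 0 <= f C y 0 r.

Lemma serve_ge fuel ts w x r :
  0 <= w -> x 0 r <= (result f (serve fuel ts w x)).2 0 r.
Proof.
elim: fuel ts w x => [|fuel IH] [|C ts] w x w0 //=.
set b := f C _; have := next_tasks_ge0 C ts w b.
case: next_tasks => ts1 w1 /= w10; apply: le_trans (IH _ _ _ w10).
by rewrite !mxE lerDl mulr_ge0 ?step_size_ge0 ?f_ge0.
Qed.

(* A call that does not complete its task raises some coordinate by c. *)
Lemma serve_sum_ge fuel ts w x :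
  0 <= w ->
  let s := result f (serve fuel ts w x) in
  \sum_r x 0 r + c * fuel%:R <=
  \sum_r s.2 0 r + c * (odflt 0%N s.1 + size ts)%:R.
Proof.
elim: fuel ts w x => [|fuel IH] [|C ts] w x w0 //=.
- by rewrite lerD2l ler_pM2l// ler_nat.
- by rewrite addn0.
set b := f C _; have := next_tasks_ge0 C ts w b.
have : c * (1 + size (next_tasks C ts w b).1)%:R <=
    \sum_r step_size w b * b 0 r + c * (size ts).+1%:R.
  rewrite /next_tasks /step_size; case: ifPn => /= [_|].
    by rewrite lerDr sumr_ge0// => r _; rewrite mulr_ge0 ?f_ge0.
  rewrite -ltNge => cwb; rewrite natrD mulrDr mulr1 lerD2r.
  have b0 : `|b| != 0.
    by apply: contraTneq cwb => ->; rewrite mulr0 -leNgt ltW.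
  have [r0 br0] := rV_norm_attained b0.
  rewrite (bigD1 r0)//= -[leLHS]addr0 lerD//.
    by rewrite br0 ger0_norm ?f_ge0// divfK// -[b 0 r0]ger0_norm ?f_ge0// -br0.
  by apply: sumr_ge0 => r _; rewrite mulr_ge0 ?f_ge0// divr_ge0// ltW.
case: next_tasks => ts1 w1 /= H w10; have := IH ts1 w1 (x + step_size w b *: b) w10.
set s := result f _; cbv zeta.
have -> : \sum_r (x + step_size w b *: b) 0 r =
    \sum_r x 0 r + \sum_r step_size w b * b 0 r.
  by rewrite -big_split/=; apply: eq_bigr => r _; rewrite !mxE.
rewrite !natrD -[fuel.+1]addn1 natrD -[(size ts).+1]addn1 natrD.
move: H; rewrite !natrD -[(size ts).+1]addn1 natrD; lra.
Qed.

Lemma phases_sum_ge p fuel x :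
  let s := result f (phases p fuel x) in
  \sum_r x 0 r + c * fuel%:R <=
  \sum_r s.2 0 r + c * (odflt 0%N s.1 + p * n)%:R.
Proof.
elim: p fuel x => [|p IH] fuel x /=; first by rewrite addn0.
rewrite result_bind; have := serve_sum_ge fuel (enum 'I_n) x ler01.
rewrite size_enum_ord; case: (result f _) => -[fuel1|] x1 /=.
  have := IH fuel1 x1; set s := result f _; cbv zeta.
  by rewrite mulSn !natrD; lra.
(* After an abort the later phases do not run; allowing for their [p * n] tasks only weakens the
   bound. *)
by move=> /le_trans; apply; rewrite lerD2l ler_pM2l// ler_nat mulSn leq_addr.
Qed.

(** * Growth of the potential on [B] against a competitor [z] of value at most [lam] there *)

Variables (B : {set 'I_m}) (z : 'I_n -> 'rV[R]_m) (lam : R).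

(** [theta] caps the increase of an exponent in one call; [zeta] is the share of the final potential
    charged to one phase. *)
Let theta := eta * c.
Let zeta := eta * (1 + 2 * theta) * lam.

Hypothesis theta_le : theta <= 2^-1.
Hypothesis z_ge0 : forall C r, 0 <= z C 0 r.
Hypothesis f_opt : forall C (y : price R m), \sum_(r in B) (y 0 r)%:num * f C y 0 r <=
                              \sum_(r in B) (y 0 r)%:num * z C 0 r.
Hypothesis z_le : forall r, r \in B -> \sum_C z C 0 r <= lam.
Hypothesis zeta_lt1 : zeta < 1.

(** Exponents grow by at most [theta], so the increase is linearized; the linear term is the cost of
    the answer at current prices, which optimality on [B] bounds by the cost of [z]. *)
Lemma potential_step C w x :
  0 <= w -> let b := f C (exp_price x) in let s := step_size w b in
  potential B (x + s *: b) <=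
  potential B x + eta * (1 + 2 * theta) * s *
    \sum_(r in B) expR (eta * x 0 r) * z C 0 r.
Proof.
move=> w0 /=; set b := f C _; set s := step_size w b; have s0 : 0 <= s by exact: step_size_ge0.
have th0 : 0 < theta by rewrite mulr_gt0.
have K0 : 0 <= eta * (1 + 2 * theta) * s.
  by rewrite !mulr_ge0 ?(ltW eta_gt0)//; lra.
apply: (@le_trans _ _ (potential B x + eta * (1 + 2 * theta) * s *
    \sum_(r in B) expR (eta * x 0 r) * b 0 r)).
  rewrite mulr_sumr -big_split/=; apply: ler_sum => r _.
  rewrite !mxE mulrDr expRD.
  have : 0 <= eta * (s * b 0 r) <= theta.
    rewrite !mulr_ge0 ?f_ge0 ?(ltW eta_gt0)//= /theta ler_pM2l//.
    by apply: le_trans (step_size_norm_le w b); rewrite ler_wpM2l// ler_coord_norm.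
  move=> /(expR_le_linear theta_le) H.
  apply: le_trans (ler_wpM2l (expR_ge0 (eta * x 0 r)) H) _.
  by rewrite le_eqVlt; apply/orP; left; apply/eqP; ring.
rewrite lerD2l ler_wpM2l//; have := f_opt C (exp_price x).
have price_sum (g : 'I_m -> R) : \sum_(r in B) (exp_price x 0 r)%:num * g r =
    \sum_(r in B) expR (eta * x 0 r) * g r.
  by apply: eq_bigr => r _; rewrite mxE.
by rewrite (price_sum (fun r => b 0 r)) (price_sum (fun r => z C 0 r)).
Qed.

(* The prices only increase, so every call may be charged at the final ones. *)
Lemma potential_serve fuel ts w x :
  0 <= w ->
  let x' := (result f (serve fuel ts w x)).2 in
  potential B x' <= potential B x + eta * (1 + 2 * theta) *
    \sum_C remaining ts w C * \sum_(r in B) expR (eta * x' 0 r) * z C 0 r.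
Proof.
have th0 : 0 < theta by rewrite mulr_gt0.
have K0 : 0 <= eta * (1 + 2 * theta) by rewrite mulr_ge0 ?(ltW eta_gt0)//; lra.
have pos x1 ts1 w1 : 0 <= w1 -> 0 <= eta * (1 + 2 * theta) *
    \sum_C remaining ts1 w1 C * \sum_(r in B) expR (eta * x1 0 r) * z C 0 r.
  move=> w10; rewrite mulr_ge0// sumr_ge0// => C _.
  rewrite mulr_ge0 ?remaining_ge0// sumr_ge0// => r _.
  by rewrite mulr_ge0// expR_ge0.
elim: fuel ts w x => [|fuel IH] [|C ts] w x w0 //=; try by rewrite lerDl pos.
have step := potential_step C x w0.
set b := f C _ in step *; have := next_tasks_ge0 C ts w b.
have := remaining_next C ts w b.
have := serve_ge fuel (next_tasks C ts w b).1 (x + step_size w b *: b).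
case: next_tasks => ts1 w1 /= mono rem w10.
have := IH ts1 w1 (x + step_size w b *: b) w10.
set x' := (result f _).2 => IH'.
apply: le_trans IH' _; apply: le_trans (lerD step (lexx _)) _.
rewrite -addrA lerD2l -mulrA -mulrDr ler_wpM2l//.
under [leRHS]eq_bigr do rewrite rem mulrDl.
rewrite big_split/= [leLHS]addrC lerD2l (bigD1 C)//= eqxx mul1r [X in _ + X]big1 ?addr0.
  rewrite ler_wpM2l ?step_size_ge0//; apply: ler_sum => r _.
  rewrite ler_wpM2r// ler_expR ler_pM2l//; apply: le_trans (mono _ r w10).
  by rewrite !mxE lerDl mulr_ge0 ?step_size_ge0 ?f_ge0.
by move=> C' C'C; rewrite eq_sym (negbTE C'C) !mul0r.
Qed.

(** Every customer starts with open demand 1, so the charges sum to at most [zeta] times the final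
    potential; solving this implicit inequality gives the factor [1 / (1 - zeta)]. *)
Lemma potential_phase fuel x :
  potential B (result f (serve fuel (enum 'I_n) 1 x)).2 <=
  potential B x * expR (zeta / (1 - zeta)).
Proof.
have th0 : 0 < theta by rewrite mulr_gt0.
have K0 : 0 <= eta * (1 + 2 * theta) by rewrite mulr_ge0 ?(ltW eta_gt0)//; lra.
have := potential_serve fuel (enum 'I_n) x ler01; set x' := (result f _).2 => /= H.
have {}H : potential B x' <= potential B x + zeta * potential B x'.
  apply: le_trans H _; rewrite lerD2l /zeta -[leRHS]mulrA ler_wpM2l//.
  under eq_bigr do rewrite remaining1 count_uniq_mem ?enum_uniq// mem_enum mul1r.
  rewrite exchange_big/= mulr_sumr; apply: ler_sum => r rB.
  by rewrite -mulr_sumr mulrC ler_wpM2r ?expR_ge0// z_le.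
have z1 : 0 < 1 - zeta by rewrite subr_gt0.
apply: (@le_trans _ _ (potential B x / (1 - zeta))).
  by rewrite ler_pdivlMr// mulrBr mulr1 [_ * zeta]mulrC lerBlDr.
by rewrite ler_wpM2l ?inv1B_le_expR// sumr_ge0// => r _; rewrite expR_ge0.
Qed.

Hypothesis lam_ge0 : 0 <= lam.

Lemma potential_phases p fuel x :
  potential B (result f (phases p fuel x)).2 <=
  potential B x * expR (p%:R * (zeta / (1 - zeta))).
Proof.
have th0 : 0 < theta by rewrite mulr_gt0.
have w0 : 0 <= zeta / (1 - zeta).
  by rewrite divr_ge0 ?subr_ge0 ?(ltW zeta_lt1)// !mulr_ge0 ?(ltW eta_gt0)//; lra.
have P0 x1 : 0 <= potential B x1 by apply: sumr_ge0 => r _; exact: expR_ge0.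
elim: p fuel x => [|p IH] fuel x /=; first by rewrite mul0r expR0 mulr1.
rewrite result_bind; have := potential_phase fuel x.
rewrite -natr1 mulrDl mul1r expRD [expR (p%:R * _) * _]mulrC (mulrA (potential B x)).
case: (result f _) => -[fuel1|] x1 /= H1.
  by apply: le_trans (IH _ _) _; rewrite ler_wpM2r ?expR_ge0.
(* An aborted run still obeys the bound of one phase, and the factors of the missing phases are at
   least 1. *)
apply: le_trans H1 _; rewrite ler_peMr ?mulr_ge0 ?expR_ge0//.
by apply: le_trans (expR_ge1Dx _); rewrite lerDl mulr_ge0.
Qed.

Lemma potential0_le : potential B 0 <= m%:R.
Proof.
rewrite /potential; under eq_bigr do rewrite mxE mulr0 expR0.
by rewrite sumr_const ler_nat -[leqRHS]card_ord max_card.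
Qed.

Lemma phases_coord_le p fuel r : r \in B ->
  eta * (result f (phases p fuel 0)).2 0 r <=
  ln m%:R + p%:R * (zeta / (1 - zeta)).
Proof.
move=> rB; have m0 : (0 < m)%N by case: (m) r {rB} => [[]|].
rewrite -ler_expR expRD lnK ?posrE ?ltr0n//.
have := potential_phases p fuel 0; set x' := (result f _).2 => H.
apply: (@le_trans _ _ (potential B x')).
  rewrite /potential (bigD1 r)//= lerDl sumr_ge0// => r' _; exact: expR_ge0.
by apply: le_trans H _; rewrite ler_wpM2r ?expR_ge0// potential0_le.
Qed.

(** At most [p * n] calls complete a unit and, under the bounds of [phases_complete], at most
    [4 * p * m] do not; the extra 1 makes exhaustion contradictory. *)
Definition phase_fuel p : nat := (4 * (p * (n + m))).+1.

(** If the fuel ran out, [phases_sum_ge] would force a larger sum of exponents than Jensen's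
    inequality allows for the final potential. *)
Lemma phases_complete p : B = [set: 'I_m]%SET -> zeta / (1 - zeta) <= 4 * theta ->
  (result f (phases p (phase_fuel p) 0)).1 != None.
Proof.
move=> BT w_le; have th0 : 0 < theta by rewrite mulr_gt0.
have := phases_sum_ge p (phase_fuel p) 0.
have := potential_phases p (phase_fuel p) 0; have := potential0_le.
case: (result f _) => -[fuel'|] x' //=.
set a := p%:R * _ => P0 P1.
have : \sum_r eta * x' 0 r <= m%:R * a.
  apply: sum_le_of_sum_expR.
  have -> : \sum_r expR (eta * x' 0 r) = potential B x'.
    by apply: eq_bigl => r; rewrite BT inE.
  by apply: le_trans P1 _; rewrite ler_wpM2r ?expR_ge0.
have sum0 : \sum_r (0 : 'rV[R]_m) 0 r = 0 by apply: big1 => r _; rewrite mxE.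
rewrite -mulr_sumr sum0.
have a_le : a <= p%:R * (4 * theta) by rewrite ler_wpM2l.
have ma_le : m%:R * a <= m%:R * (p%:R * (4 * theta)) by rewrite ler_wpM2l.
rewrite add0n add0r natrM => H1.
rewrite -(ler_pM2l eta_gt0) mulrDr !mulrA -/theta => H2.
suff : theta * (phase_fuel p)%:R <= theta * (4 * (p * (n + m)))%:R.
  by rewrite ler_pM2l// ler_nat /phase_fuel ltnn.
apply: le_trans H2 _; rewrite !natrM natrD.
have pn : 0 <= theta * (p%:R * n%:R) by rewrite !mulr_ge0// ltW.
nra.
Qed.

End MultiplicativeWeights.
Arguments phases : simpl never.
Arguments phase_fuel : simpl never.

(** * Infima of nonnegative functions *)

Section Minimum.
Variables (R : realType) (T : Type) (A : set T) (g : T -> R).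
Hypothesis g_ge0 : forall x, A x -> 0 <= g x.

Lemma minimum_le x : A x -> minimum A g <= g x.
Proof.
move=> Ax; apply: ge_inf; last by exists x.
by exists 0 => _ [y Ay <-]; exact: g_ge0.
Qed.

Lemma le_minimum a : A !=set0 -> (forall x, A x -> a <= g x) -> a <= minimum A g.
Proof.
move=> [x0 Ax0] ag; apply: lb_le_inf; first by exists (g x0), x0.
by move=> _ [y Ay <-]; exact: ag.
Qed.

(** Near-minimizers stand in for minimizers: competitors are taken at values strictly above the
    minimum. *)
Lemma minimum_lt_ex a : A !=set0 -> minimum A g < a -> exists2 x, A x & g x < a.
Proof.
move=> [x0 Ax0] /inf_lt; case; first by exists (g x0), x0.
by move=> _ [x Ax <-] gxa; exists x.
Qed.

End Minimum.

(** * The algorithm and bounds on its calls *)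

Section Algorithm.
Variables (R : realType) (n m : nat).

Definition unit_price : price R m := const_mx (NngNum ler01).

Fixpoint collect (ts : seq 'I_n) (x : 'rV[R]_m) : prog R n m 'rV[R]_m :=
  if ts is C :: ts' then Ask C unit_price (fun b => collect ts' (x + b))
  else Ret x.

(* Invariant: l <= lambda* <= 16 * 2 ^ j * l. Running k %/ 2 ^ j' + 1 phases at
   scale 2 * l either shows lambda* <= 16 * 2 ^ j' * l or lambda* >= 2 * l. The
   numbers of phases grow geometrically, so that their sum is O(k). *)
Fixpoint scale_search (k j : nat) (l : R) : prog R n m R :=
  if j is j'.+1 then
    let p := (k %/ 2 ^ j').+1 in
    bind (phases n (8 * l)^-1 (4 * l) p (phase_fuel n m p) 0) (fun s =>
      scale_search k j'
        (if (s.1 != None) && (`|s.2| <= 16 * 2 ^+ j' * l * p%:R)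
         then l else 2 * l))
  else Ret l.

Definition log2_bound : nat := (trunc_log 2 m).+1.

Definition phase_count (eps : R) : nat :=
  (Num.truncn (log2_bound%:R / eps ^+ 2)).+1.

(** On a valid instance a zero sum means [x0 = 0], which is optimal on every block. Otherwise
    [lambda* <= 16 * l] puts the final scale [32 * l] strictly above [lambda*], and there
    [eta * c = eps]. *)
Definition solver (delta : R) : prog R n m 'rV[R]_m :=
  bind (collect (enum 'I_n) 0) (fun x0 =>
    if \sum_r x0 0 r == 0 then Ret x0 else
    bind (scale_search log2_bound log2_bound ((\sum_r x0 0 r) / m%:R)) (fun l =>
      let eps := delta / 64 in
      let p := phase_count eps in
      bind (phases n (eps / (32 * l)) (32 * l) p (phase_fuel n m p) 0) (fun s =>
        Ret (p%:R^-1 *: s.2)))).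

Lemma ln_le_log2_bound : (0 < m)%N -> ln (m%:R : R) <= log2_bound%:R.
Proof.
move=> m0; apply: (@le_trans _ _ (ln ((2 : R) ^+ log2_bound))).
  rewrite ler_ln ?posrE ?ltr0n ?exprn_gt0// -natrX ler_nat.
  exact/ltnW/trunc_log_ltn.
rewrite lnXn// -[leLHS]mulr_natl ler_piMr//.
by have := @le_ln1Dx R 1; apply; lra.
Qed.

Lemma ln2_ge : 2^-1 <= ln (2 : R).
Proof.
have := @le_ln1Dx R (- 2^-1); have -> : 1 + - 2^-1 = 2^-1 :> R by field.
by rewrite lnV ?posrE// lerN2; apply; lra.
Qed.

(** Since [ln 2 >= 1/2], the truncated logarithm and the added 1 each cost at most twice the natural
    logarithm. *)
Lemma log2_bound_le : log2_bound%:R <= 4 * ln ((maxn m 2)%:R : R).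
Proof.
have ln2 := ln2_ge; have M2 : ln (2 : R) <= ln (maxn m 2)%:R.
  by rewrite ler_ln ?posrE ?ltr0n ?leq_max ?orbT// ler_nat leq_maxr.
have : (trunc_log 2 m)%:R * ln (2 : R) <= ln (maxn m 2)%:R.
  have [->|m0] := posnP m; first by rewrite trunc_log0 mul0r; lra.
  rewrite mulr_natl -lnXn// ler_ln ?posrE ?exprn_gt0 ?ltr0n ?leq_max ?orbT//.
  by rewrite -natrX ler_nat leq_max trunc_logP.
have : (trunc_log 2 m)%:R * 2^-1 <= (trunc_log 2 m)%:R * ln (2 : R).
  by rewrite ler_wpM2l.
have -> : log2_bound%:R = (trunc_log 2 m)%:R + 1 :> R by rewrite natr1.
lra.
Qed.

Lemma sum_div_expn2_le k j : (\sum_(i < j) k %/ 2 ^ i <= 2 * k)%N.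
Proof.
(* Strengthened by a bound for the tail: halving the tail releases the next summand. *)
suff : (\sum_(i < j) k %/ 2 ^ i + 2 * (k %/ 2 ^ j) <= 2 * k)%N.
  by apply: leq_trans; exact: leq_addr.
elim: j => [|j IH]; first by rewrite big_ord0 divn1.
rewrite big_ord_recr/=; apply: leq_trans IH.
rewrite -addnA leq_add2l expnSr divnMA.
rewrite (mul2n (k %/ 2 ^ j)) -addnn leq_add2l.
by rewrite mulnC leq_divM.
Qed.

Variable f : 'I_n -> price R m -> 'rV[R]_m.

Lemma calls_collect ts x : calls f (collect ts x) = size ts.
Proof. by elim: ts x => //= C ts IH x; rewrite IH. Qed.

Lemma result_collect ts x :
  result f (collect ts x) = x + \sum_(C <- ts) f C unit_price.
Proof.
elim: ts x => [|C ts IH] x /=; first by rewrite big_nil addr0.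
by rewrite IH big_cons addrA.
Qed.

Lemma calls_phases_le eta c p fuel x :
  (calls f (phases n eta c p fuel x) <= fuel)%N.
Proof. by rewrite -[leqRHS](calls_phases eta c f p fuel x) leq_addr. Qed.

Lemma phase_fuel_le p : (0 < n + m)%N -> (phase_fuel n m p.+1 <= 5 * (p.+1 * (n + m)))%N.
Proof.
move=> nm; have : (0 < p.+1 * (n + m))%N by rewrite muln_gt0.
by rewrite /phase_fuel; case: (_ * _)%N => // q _; rewrite (mulSn 4) addnC -addn1 leq_add2l.
Qed.

Lemma calls_scale_search k j l : (0 < n + m)%N ->
  (calls f (scale_search k j l) <=
   5 * ((\sum_(i < j) (k %/ 2 ^ i).+1) * (n + m)))%N.
Proof.
move=> nm; elim: j l => [|j IH] l //=; rewrite calls_bind.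
rewrite big_ord_recr/= mulnDl (mulnDr 5) [leqLHS]addnC leq_add ?IH//.
exact: leq_trans (calls_phases_le _ _ _ _ _) (phase_fuel_le _ nm).
Qed.

End Algorithm.

(** * Exchanging a single block in a product *)

Section ProductStructure.
Variables (R : realType) (n m : nat) (X : 'I_n -> set 'rV[R]_m).
Implicit Types (B : {set 'I_m}) (x : 'rV[R]_m).

Lemma minkowski_sum_ex (V : zmodType) (A : 'I_n -> set V) :
  (forall C, A C !=set0) -> minkowski_sum A !=set0.
Proof. by move=> /choice[a Aa]; exists (\sum_C a C), a. Qed.

Definition glue (B : {set 'I_m}) (v : 'rV[R]_#|B|) (x : 'rV[R]_m) : 'rV[R]_m :=
  \row_r if [pick j | enum_val j == r] is Some j then v 0 j else x 0 r.

Lemma glue_enum_val B (v : 'rV[R]_#|B|) x j : glue v x 0 (enum_val j) = v 0 j.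
Proof.
rewrite mxE; case: pickP => [i /eqP /enum_val_inj -> //|/(_ j)].
by rewrite eqxx.
Qed.

Lemma glue_notin B (v : 'rV[R]_#|B|) x r : r \notin B -> glue v x 0 r = x 0 r.
Proof.
rewrite mxE; case: pickP => // j /eqP <-.
by rewrite enum_valP.
Qed.

Lemma restrict_glue B (v : 'rV[R]_#|B|) x : Defs.restrict B (glue v x) = v.
Proof. by apply/rowP => j; rewrite mxE glue_enum_val. Qed.

Lemma restrict_sum B (z : 'I_n -> 'rV[R]_m) :
  Defs.restrict B (\sum_C z C) = \sum_C Defs.restrict B (z C).
Proof.
apply/rowP => j; rewrite mxE !summxE.
by apply: eq_bigr => C _; rewrite mxE.
Qed.

Lemma norm_restrict_le B (x : 'rV[R]_m) : `|Defs.restrict B x| <= `|x|.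
Proof.
apply: rV_norm_le => // j; rewrite mxE ler_norml ler_coord_norm andbT.
by rewrite lerNl -normrN; apply: le_trans (ler_coord_norm _ (enum_val j)); rewrite mxE.
Qed.

Variables (P : {set {set 'I_m}}) (Y : 'I_n -> forall B : {set 'I_m}, set 'rV[R]_#|B|).
Arguments Y : clear implicits.
Hypothesis prod : product_structure X P Y.

Lemma product_restrict C x B : B \in P -> X C x -> Y C B (Defs.restrict B x).
Proof. by case: prod => _ _ XY BP; rewrite XY => /(_ B BP). Qed.

(** Blocks are disjoint, so overwriting one leaves the restrictions to the others unchanged. *)
Lemma product_glue C x B (v : 'rV[R]_#|B|) :
  B \in P -> X C x -> Y C B v -> X C (glue v x).
Proof.
case: prod => /and3P[_ /finset.trivIsetP disj _] _ XY BP; rewrite XY /= => Xx Yv B' B'P.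
have [->|B'B] := eqVneq B' B; first by rewrite restrict_glue.
have -> : Defs.restrict B' (glue v x) = Defs.restrict B' x; last exact: Xx.
apply/rowP => j; rewrite !mxE.
case: pickP => // i /eqP e; have := disj _ _ BP B'P; rewrite eq_sym B'B => /(_ isT).
by move=> /disjointFr /(_ (enum_valP i)); rewrite e enum_valP.
Qed.

Hypothesis rs : resource_sharing X.

Lemma factor_ex B C : B \in P -> Y C B !=set0.
Proof.
by move=> BP; have [[x Xx] _ _ _] := rs C; exists (Defs.restrict B x); exact: product_restrict.
Qed.

Definition block_value B : R :=
  minimum (minkowski_sum (fun C => Y C B)) (fun z => `|z|).

Lemma block_value_ge0 B : B \in P -> 0 <= block_value B.
Proof.
move=> BP; apply: le_minimum => //; apply: minkowski_sum_ex => C.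
exact: factor_ex.
Qed.

Lemma block_value_le_lambda_star B : B \in P -> block_value B <= lambda_star X.
Proof.
move=> BP; apply: le_minimum.
  by apply: minkowski_sum_ex => C; have [] := rs C.
move=> _ [x Xx <-]; apply: le_trans (norm_restrict_le B _).
apply: minimum_le => //; rewrite restrict_sum; exists (fun C => Defs.restrict B (x C)) => //.
by move=> C; apply: product_restrict => //; exact: Xx.
Qed.

(** A near-optimal block solution is glued into arbitrary points of the sets [X C], giving a full
    competitor that is good on [B]. *)
Lemma block_value_witness B mu : B \in P -> block_value B < mu ->
  exists2 z : 'I_n -> 'rV[R]_m, forall C, X C (z C) &
    forall r, r \in B -> \sum_C z C 0 r <= mu.
Proof.
move=> BP /minimum_lt_ex[|_ [v Yv <-] vmu].
  by apply: minkowski_sum_ex => C; exact: factor_ex.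
have /choice[x Xx] C : exists x, X C x by have [] := rs C.
exists (fun C => glue (v C) (x C)).
  by move=> C; apply: product_glue => //; exact: Yv.
move=> r rB; rewrite -(enum_rankK_in rB rB).
under eq_bigr do rewrite glue_enum_val.
rewrite -summxE; exact: le_trans (ler_coord_norm _ _) (ltW vmu).
Qed.

End ProductStructure.

(** * What an exact block solver guarantees for a run of phases *)

Section ExactSolver.
Variables (R : realType) (n m : nat) (X : 'I_n -> set 'rV[R]_m).
Variable f : 'I_n -> price R m -> 'rV[R]_m.
Hypotheses (rs : resource_sharing X) (bs : block_solver 1 X f).

Lemma oracle_in C y : X C (f C y).
Proof. by have [] := bs C y. Qed.

Lemma instance_ge0 C x r : X C x -> 0 <= x 0 r.
Proof. by have [_ _ _ X0] := rs C => /X0; apply. Qed.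

Lemma oracle_ge0 C y r : 0 <= f C y 0 r.
Proof. exact: instance_ge0 (oracle_in C y). Qed.

Lemma oracle_cost_le C y z : X C z -> cost y (f C y) <= cost y z.
Proof.
move=> Xz; have [_] := bs C y; rewrite mul1r => /le_trans; apply.
apply: minimum_le => // x Xx; apply: sumr_ge0 => r _.
by rewrite mulr_ge0// (instance_ge0 _ Xx).
Qed.

(** The optimality used by the potential argument; it holds for each block and for all resources
    together, and the algorithm never refers to [B]. *)
Definition optimal_on (B : {set 'I_m}) : Prop :=
  forall C (y : price R m) z, X C z ->
  \sum_(r in B) (y 0 r)%:num * f C y 0 r <= \sum_(r in B) (y 0 r)%:num * z 0 r.

Lemma optimal_on_setT : optimal_on [set: 'I_m]%SET.
Proof.
move=> C y z /(oracle_cost_le y); rewrite /cost => fz.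
by under eq_bigl do rewrite inE; under [leRHS]eq_bigl do rewrite inE.
Qed.

(* Replacing only the coordinates of f C y in the block B stays within X C. *)
Lemma optimal_on_block P Y B : product_structure X P Y -> B \in P -> optimal_on B.
Proof.
move=> prod BP C y z Xz.
have := oracle_cost_le y (product_glue prod BP (oracle_in C y)
  (product_restrict prod BP Xz)).
rewrite /cost (bigID (mem B))/= [leRHS](bigID (mem B))/=.
rewrite [X in _ -> _ <= X](eq_bigr (fun r =>
  (y 0 r)%:num * glue (Defs.restrict B z) (f C y) 0 r)).
  rewrite [X in _ <= _ + X -> _](eq_bigr (fun r => (y 0 r)%:num * f C y 0 r)).
    by rewrite lerD2r.
  by move=> r rB; rewrite glue_notin.
by move=> r rB; rewrite -(enum_rankK_in rB rB) glue_enum_val mxE.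
Qed.

Lemma minkowski_ex : minkowski_sum X !=set0.
Proof. by apply: minkowski_sum_ex => C; have [] := rs C. Qed.

Lemma minkowski_ge0 x r : minkowski_sum X x -> 0 <= x 0 r.
Proof.
move=> [z Xz <-]; rewrite summxE; apply: sumr_ge0 => C _.
by apply: (instance_ge0 (C := C)); exact: Xz.
Qed.

Lemma lambda_star_le x : minkowski_sum X x -> lambda_star X <= `|x|.
Proof. by move=> Xx; exact: minimum_le. Qed.

Lemma lambda_star_ge0 : 0 <= lambda_star X.
Proof. by apply: le_minimum => //; exact: minkowski_ex. Qed.

Lemma lambda_star_witness lam : lambda_star X < lam ->
  exists2 z : 'I_n -> 'rV[R]_m, forall C, X C (z C) &
    forall r, \sum_C z C 0 r <= lam.
Proof.
move=> /(minimum_lt_ex minkowski_ex)[_ [z Xz <-] zlam]; exists z => // r.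
by rewrite -summxE; exact: le_trans (ler_coord_norm _ _) (ltW zlam).
Qed.

Lemma phases_minkowski eta c p fuel : 0 < c -> (0 < p)%N ->
  let s := result f (phases n eta c p fuel 0) in
  s.1 != None -> minkowski_sum X (p%:R^-1 *: s.2).
Proof.
move=> c0 p0; case e: (result f _) => [[fuel'|] x'] //= _.
have [|u Xu ->] := phases_feasible c0 _ oracle_in e.
  by move=> C; have [] := rs C.
exists u => //; rewrite add0r scalerA mulVf ?scale1r// pnatr_eq0.
by rewrite -lt0n.
Qed.

(** For [zeta <= 1/2] one has [zeta / (1 - zeta) <= 2 * zeta], and the last hypothesis bounds this
    by [4 * eta * c]. *)
Lemma phases_complete_lambda_star eta c lam p :
  0 < eta -> 0 < c -> eta * c <= 2^-1 -> lambda_star X < lam ->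
  eta * (1 + 2 * (eta * c)) * lam <= 2^-1 ->
  eta * (1 + 2 * (eta * c)) * lam <= 2 * (eta * c) ->
  (result f (phases n eta c p (phase_fuel n m p) 0)).1 != None.
Proof.
move=> eta0 c0 th /[dup] lamb /lambda_star_witness[z Xz zlam] zeta2 zeta4.
have lam0 : 0 <= lam := le_trans lambda_star_ge0 (ltW lamb).
have th0 : 0 < eta * c by rewrite mulr_gt0.
apply: (phases_complete eta0 c0 oracle_ge0 (B := [set: 'I_m]%SET) (z := z) (lam := lam)) => //.
- by move=> C r; exact: instance_ge0 (Xz C).
- by move=> C y; apply: optimal_on_setT.
- by lra.
set zeta := eta * (1 + 2 * (eta * c)) * lam in zeta2 zeta4 *.
have zeta0 : 0 <= zeta by rewrite !mulr_ge0 ?(ltW eta0)//; lra.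
move: zeta zeta0 zeta2 zeta4 => zeta *; rewrite ler_pdivrMr; nra.
Qed.

Lemma phases_block_le B z eta c lam p fuel r :
  0 < eta -> 0 < c -> eta * c <= 2^-1 -> 0 <= lam ->
  eta * (1 + 2 * (eta * c)) * lam <= 2^-1 ->
  optimal_on B -> (forall C, X C (z C)) ->
  (forall r, r \in B -> \sum_C z C 0 r <= lam) -> r \in B ->
  eta * (result f (phases n eta c p fuel 0)).2 0 r <=
  ln m%:R + p%:R * (eta * (1 + 2 * (eta * c)) * lam *
    (1 + 2 * (eta * (1 + 2 * (eta * c)) * lam))).
Proof.
move=> eta0 c0 th lam0 zeta2 optB Xz zlam rB.
have th0 : 0 < eta * c by rewrite mulr_gt0.
set zeta := eta * (1 + 2 * (eta * c)) * lam in zeta2 *.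
apply: (@le_trans _ _ (ln m%:R + p%:R * (zeta / (1 - zeta)))).
  apply: (phases_coord_le eta0 c0 oracle_ge0 (B := B) (z := z) (lam := lam)) => //.
  - by move=> C r'; exact: instance_ge0 (Xz C).
  - by move=> C y; apply: optB.
  - by rewrite -/zeta; lra.
have zeta0 : 0 <= zeta by rewrite !mulr_ge0 ?(ltW eta0)//; lra.
rewrite lerD2l ler_wpM2l//.
move: zeta zeta0 zeta2 => zeta *; rewrite ler_pdivrMr; nra.
Qed.

End ExactSolver.

(** * Guarantees of the scale search and of the final run *)

Section Analysis.
Variables (R : realType) (n m : nat) (X : 'I_n -> set 'rV[R]_m).
Variable f : 'I_n -> price R m -> 'rV[R]_m.
Hypotheses (rs : resource_sharing X) (bs : block_solver 1 X f).
Hypothesis m_gt0 : (0 < m)%N.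

(** At this scale [eta * c = 1/2], and [zeta = 1/2] for a competitor of value [2 * l]; hence
    [zeta * (1 + 2 * zeta) = 1] and exponents stay below [ln m + p]. *)
Lemma scale_test (l : R) p : 0 < l -> (0 < p)%N -> lambda_star X < 2 * l ->
  let s := result f (phases n (8 * l)^-1 (4 * l) p (phase_fuel n m p) 0) in
  s.1 != None /\ `|s.2| <= 8 * l * (ln m%:R + p%:R).
Proof.
move=> l0 p0 lam; have l_neq0 : l != 0 by rewrite gt_eqF.
have c0 : 0 < 4 * l by lra.
have eta0 : 0 < (8 * l)^-1 by rewrite invr_gt0; lra.
have th : (8 * l)^-1 * (4 * l) = 2^-1 by field.
have zeta : (8 * l)^-1 * (1 + 2 * ((8 * l)^-1 * (4 * l))) * (2 * l) = 2^-1.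
  by rewrite th; field.
have complete : (result f (phases n (8 * l)^-1 (4 * l) p (phase_fuel n m p) 0)).1
    != None.
  by apply: (phases_complete_lambda_star rs bs p eta0 c0 _ lam); rewrite ?zeta ?th; lra.
have Xs := phases_minkowski rs bs c0 p0 complete; split=> //.
have [z Xz zlam] := lambda_star_witness rs lam.
have lnm : 0 <= ln (m%:R : R) by rewrite ln_ge0// ler1n.
apply: rV_norm_le => [|r]; first by rewrite mulr_ge0 ?addr_ge0//; lra.
rewrite ger0_norm; last first.
  have := minkowski_ge0 rs r Xs.
  by rewrite mxE pmulr_rge0 ?invr_gt0 ?ltr0n.
rewrite -ler_pdivrMl; last by lra.
have := phases_block_le (lam := 2 * l) rs bs p (phase_fuel n m p) eta0 c0 _ _ _
  (optimal_on_setT rs bs) Xz (fun r _ => zlam r) (finset.in_setT r).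
rewrite zeta th => bound; apply: le_trans (bound _ _ _) _; lra.
Qed.

(** On success the average over the phases witnesses the halved upper bound; on failure [scale_test]
    rules out [lambda* < 2 * l], so the lower bound doubles. *)
Lemma scale_search_spec j (l : R) : 0 < l ->
  l <= lambda_star X <= 16 * 2 ^+ j * l ->
  let l' := result f (scale_search n m (log2_bound m) j l) in
  0 < l' /\ l' <= lambda_star X <= 16 * l'.
Proof.
elim: j l => [|j IH] l l0 /=; first by rewrite expr0 mulr1.
move=> /andP[l_le le_l]; rewrite result_bind.
set p := (_ %/ _).+1; have := @scale_test l p l0 isT.
set s := result f (phases _ _ _ _ _ _); cbv zeta => test.
(* Rounding up in [p] makes [2 ^ j * p] exceed [log2_bound m]. *)
have ln_le : ln m%:R <= 2 ^+ j * p%:R :> R.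
  apply: le_trans (ln_le_log2_bound R m_gt0) _.
  by rewrite -natrX -natrM ler_nat mulnC ltnW// ltn_ceil// expn_gt0.
have j1 : 1 <= 2 ^+ j :> R by rewrite exprn_ege1// ler1n.
have p1 : 1 <= p%:R :> R by rewrite ler1n.
case: ifPn => [/andP[s1 s2]|sN]; apply: IH => //; rewrite ?mulr_gt0//.
  rewrite l_le /=; apply: le_trans (lambda_star_le (phases_minkowski rs bs _ _ s1)) _ => //.
    by lra.
  rewrite normrZ ger0_norm ?invr_ge0// ler_pdivrMl ?ltr0n//.
  by rewrite [leRHS]mulrC.
have -> : 16 * 2 ^+ j * (2 * l) = 16 * 2 ^+ j.+1 * l by rewrite exprS; ring.
rewrite le_l andbT leNgt; apply: contra sN => /test[-> s2] /=.
apply: le_trans s2 _.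
have -> : 16 * 2 ^+ j * l * p%:R = 8 * l * (2 ^+ j * p%:R + 2 ^+ j * p%:R) by ring.
by rewrite ler_wpM2l ?mulr_ge0 ?(ltW l0)// lerD// ler_peMl.
Qed.

Lemma phase_count_ge (eps : R) : 0 < eps ->
  (log2_bound m)%:R <= eps ^+ 2 * (phase_count m eps)%:R.
Proof.
move=> eps0; rewrite -ler_pdivrMl ?exprn_gt0// mulrC ltW//.
by have /andP[] := truncn_itv (divr_ge0 (ler0n R (log2_bound m)) (ltW (exprn_gt0 2 eps0))).
Qed.

Lemma phase_count_le (eps : R) : 0 < eps ->
  (phase_count m eps)%:R <= (log2_bound m)%:R / eps ^+ 2 + 1.
Proof.
move=> eps0; rewrite /phase_count -natr1 lerD2r.
by have /andP[] := truncn_itv (divr_ge0 (ler0n R (log2_bound m)) (ltW (exprn_gt0 2 eps0))).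
Qed.

Lemma final_complete (l eps : R) p : 0 < l -> 0 < eps <= 64^-1 ->
  lambda_star X <= 16 * l ->
  (result f (phases n (eps / (32 * l)) (32 * l) p (phase_fuel n m p) 0)).1 != None.
Proof.
move=> l0 /andP[eps0 eps1] lam; have l_neq0 : l != 0 by rewrite gt_eqF.
have c0 : 0 < 32 * l by lra.
have th : eps / (32 * l) * (32 * l) = eps by field.
have zeta : eps / (32 * l) * (1 + 2 * (eps / (32 * l) * (32 * l))) * (32 * l) =
    eps * (1 + 2 * eps) by rewrite th; field.
apply: (phases_complete_lambda_star rs bs p (lam := 32 * l)); rewrite ?zeta ?th//;
  by [rewrite divr_gt0|lra|nra].
Qed.

(** The logarithmic term costs [32 * l * eps <= 32 * eps * lambda*], and the factor [1 + 14 * eps]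
    on the block value costs [14 * eps * lambda*]; 64 covers both. *)
Lemma final_coord_le (l eps : R) B lamB r : 0 < l -> 0 < eps <= 64^-1 ->
  l <= lambda_star X <= 16 * l -> 0 <= lamB <= lambda_star X ->
  optimal_on X f B ->
  (forall mu, lamB < mu -> exists2 z : 'I_n -> 'rV[R]_m,
    forall C, X C (z C) & forall r, r \in B -> \sum_C z C 0 r <= mu) ->
  r \in B ->
  let p := phase_count m eps in
  let s := result f (phases n (eps / (32 * l)) (32 * l) p (phase_fuel n m p) 0) in
  p%:R^-1 * s.2 0 r <= lamB + 64 * eps * lambda_star X.
Proof.
move=> l0 /andP[eps0 eps1] /andP[l_le le_l] /andP[lamB0 lamB_le] optB wit rB /=.
have l_neq0 : l != 0 by rewrite gt_eqF.
have c0 : 0 < 32 * l by lra.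
set p := phase_count m eps; set s := result f _.
have p0 : 0 < p%:R :> R by rewrite ltr0n.
have eta0 : 0 < eps / (32 * l) by rewrite divr_gt0.
have th : eps / (32 * l) * (32 * l) = eps by field.
apply/ler_addgt0Pr => e e0.
(* The part [e / 2] leaves room for the factor [1 + 14 * eps]; the part [16 * l] keeps
   [mu <= 32 * l], hence [zeta <= 2 * eps]. *)
pose mu := lamB + Num.min (e / 2) (16 * l).
have mu_gt : lamB < mu by rewrite ltrDl lt_min; apply/andP; split; lra.
have mu_e : mu <= lamB + e / 2 by rewrite lerD2l ge_min lexx.
have mu_l : mu <= 32 * l.
  have : mu <= lamB + 16 * l by rewrite lerD2l ge_min lexx orbT.
  by lra.
have mu0 : 0 <= mu by lra.
have [z Xz zmu] := wit mu mu_gt.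
pose zeta := eps / (32 * l) * (1 + 2 * eps) * mu.
have zeta_le : zeta <= 2 * eps.
  have t1 : mu / (32 * l) <= 1 by rewrite ler_pdivrMr// mul1r.
  have -> : zeta = eps * (1 + 2 * eps) * (mu / (32 * l)) by rewrite /zeta; field.
  apply: (@le_trans _ _ (eps * (1 + 2 * eps) * 1)); last by nra.
  by rewrite ler_wpM2l//; nra.
have zeta_half : zeta <= 2^-1 by lra.
have := phases_block_le rs bs p (phase_fuel n m p) eta0 c0 _ mu0 _ optB Xz zmu rB.
rewrite th -/zeta -/s => /(_ _ zeta_half) bound.
have {}bound : eps / (32 * l) * s.2 0 r <= ln m%:R + p%:R * (zeta * (1 + 2 * zeta)).
  by apply: bound; lra.
have K0 : 0 < 32 * l / eps by rewrite divr_gt0.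
have := ler_wpM2l (ltW K0) bound; rewrite mulrDr.
have -> : 32 * l / eps * (eps / (32 * l) * s.2 0 r) = s.2 0 r.
  by field; rewrite l_neq0 gt_eqF.
have zeta_eta : 32 * l / eps * zeta = (1 + 2 * eps) * mu.
  by rewrite /zeta; field; rewrite l_neq0 gt_eqF.
have -> : 32 * l / eps * (p%:R * (zeta * (1 + 2 * zeta))) =
    p%:R * ((1 + 2 * eps) * mu * (1 + 2 * zeta)) by rewrite -zeta_eta; ring.
have ln_le : 32 * l / eps * ln m%:R <= p%:R * (32 * l * eps).
  have -> : p%:R * (32 * l * eps) = 32 * l / eps * (eps ^+ 2 * p%:R).
    by field; rewrite gt_eqF.
  rewrite ler_wpM2l ?(ltW K0)//.
  exact: le_trans (ln_le_log2_bound R m_gt0) (phase_count_ge eps0).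
have zeta_lin : (1 + 2 * eps) * mu * (1 + 2 * zeta) <= (1 + 14 * eps) * mu.
  have : (1 + 2 * eps) * (1 + 2 * zeta) <= 1 + 14 * eps by nra.
  by move=> /(ler_wpM2r mu0); rewrite mulrAC.
have mu_lin : (1 + 14 * eps) * mu <= lamB + 14 * (eps * lambda_star X) + e.
  have : (1 + 14 * eps) * mu <= (1 + 14 * eps) * (lamB + e / 2).
    by rewrite ler_wpM2l//; lra.
  have : eps * lamB <= eps * lambda_star X by rewrite ler_wpM2l// ltW.
  have : eps * e <= 64^-1 * e by rewrite ler_wpM2r// ltW.
  lra.
have l_eps : l * eps <= eps * lambda_star X by rewrite mulrC ler_wpM2l// ltW.
have lam_eps : 0 <= eps * lambda_star X by rewrite mulr_ge0 ?lambda_star_ge0// ltW.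
move=> bound'; rewrite ler_pdivrMl//; apply: le_trans bound' _.
apply: le_trans (lerD ln_le (ler_wpM2l (ltW p0) zeta_lin)) _.
by rewrite -mulrDr ler_wpM2l ?(ltW p0)//; lra.
Qed.

End Analysis.

(** * The starting scale from unit prices *)

Section Initialisation.
Variables (R : realType) (n m : nat) (X : 'I_n -> set 'rV[R]_m).
Variable f : 'I_n -> price R m -> 'rV[R]_m.
Hypotheses (rs : resource_sharing X) (bs : block_solver 1 X f).

Let x0 : 'rV[R]_m := \sum_C f C (unit_price R m).

Lemma initial_minkowski : minkowski_sum X x0.
Proof. by exists (fun C => f C (unit_price R m)) => // C; exact: (oracle_in bs). Qed.

Lemma initial_sum_ge0 : 0 <= \sum_r x0 0 r.
Proof. by apply: sumr_ge0 => r _; exact: (minkowski_ge0 rs r initial_minkowski). Qed.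

Lemma lambda_star_le_initial : lambda_star X <= \sum_r x0 0 r.
Proof.
apply: le_trans (lambda_star_le initial_minkowski) _.
have x00 r : 0 <= x0 0 r := minkowski_ge0 rs r initial_minkowski.
apply: rV_norm_le => [|r]; first exact: initial_sum_ge0.
by rewrite ger0_norm// (bigD1 r)//= lerDl sumr_ge0.
Qed.

(** At unit prices the oracle minimizes the coordinate sum, which is at most [m] times the norm. *)
Lemma initial_le_lambda_star : (0 < m)%N ->
  (\sum_r x0 0 r) / m%:R <= lambda_star X.
Proof.
move=> m0; apply: le_minimum; first exact: minkowski_ex.
move=> _ [z Xz <-]; rewrite ler_pdivrMr ?ltr0n//.
have sum_cost (u : 'rV[R]_m) : cost (unit_price R m) u = \sum_r u 0 r.
  by apply: eq_bigr => r _; rewrite mxE mul1r.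
apply: (@le_trans _ _ (\sum_r (\sum_C z C) 0 r)).
  rewrite /x0; under eq_bigr do rewrite summxE.
  under [leRHS]eq_bigr do rewrite summxE.
  rewrite exchange_big [leRHS]exchange_big/=; apply: ler_sum => C _.
  by rewrite -!sum_cost; apply: (oracle_cost_le rs bs); exact: Xz.
apply: (@le_trans _ _ (\sum_(r < m) `|\sum_C z C|)).
  by apply: ler_sum => r _; exact: ler_coord_norm.
by rewrite sumr_const card_ord mulr_natr.
Qed.

End Initialisation.

Lemma sum_rV_neq0 (R : realType) (m : nat) (x : 'rV[R]_m) :
  \sum_r x 0 r != 0 -> (0 < m)%N.
Proof. by case: m x => // x; rewrite big_ord0 eqxx. Qed.

(** * Correctness and call count of the whole algorithm *)

Section Solver.
Variables (R : realType) (n m : nat) (X : 'I_n -> set 'rV[R]_m).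
Variable f : 'I_n -> price R m -> 'rV[R]_m.
Hypotheses (rs : resource_sharing X) (bs : block_solver 1 X f).
Variable delta : R.
Hypothesis delta01 : 0 < delta <= 1.

Lemma solver_spec P Y : product_structure X P Y ->
  let x := result f (solver n m delta) in
  minkowski_sum X x /\ forall B, B \in P ->
    \big[Num.max/0]_(r in B) x 0 r <= block_value Y B + delta * lambda_star X.
Proof.
move=> prod /=; have /andP[d0 d1] := delta01; have lam0 := lambda_star_ge0 rs.
have rhs0 B : B \in P -> 0 <= block_value Y B + delta * lambda_star X.
  by move=> BP; rewrite addr_ge0 ?mulr_ge0 ?(block_value_ge0 prod rs BP)// ltW.
rewrite /solver result_bind result_collect add0r big_enum/=.
have Xx0 := initial_minkowski bs; have lam_le := lambda_star_le_initial rs bs.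
have le_lam := initial_le_lambda_star rs bs; have S0 := initial_sum_ge0 rs bs.
have x00 r := minkowski_ge0 rs r Xx0.
set x0 := \sum_C f C _ in Xx0 lam_le le_lam S0 x00 *.
case: eqP => [S00|/eqP Sneq0] /=.
  split=> // B BP; apply: bigmax_le; first exact: rhs0.
  move=> r _; apply: le_trans (rhs0 B BP).
  by move: S00; rewrite (bigD1 r)//= => <-; rewrite lerDl sumr_ge0.
have Sgt0 : 0 < \sum_r x0 0 r by rewrite lt_neqAle eq_sym Sneq0.
have m0 := sum_rV_neq0 Sneq0.
rewrite 2!result_bind /=.
have [||l0 /andP[l_le le_l]] := scale_search_spec rs bs m0 (j := log2_bound m)
    (l := (\sum_r x0 0 r) / m%:R).
- by rewrite divr_gt0 ?ltr0n.
(* The initial bounds differ by the factor [m], which [2 ^ log2_bound m] covers. *)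
- rewrite le_lam//=; apply: le_trans lam_le _.
  rewrite mulrCA ler_peMr// ler_pdivlMr ?ltr0n// mul1r.
  apply: (@le_trans _ _ (2 ^+ log2_bound m)).
    by rewrite -natrX ler_nat ltnW// trunc_log_ltn.
  by rewrite ler_peMl ?exprn_ge0// ler1n.
set l := result f _ in l0 l_le le_l *.
have eps01 : 0 < delta / 64 <= 64^-1 by apply/andP; split; lra.
have complete p := final_complete rs bs p l0 eps01 le_l.
have c0 : 0 < 32 * l by lra.
split; first exact: (phases_minkowski rs bs c0 _ (complete (phase_count _ _))).
move=> B BP; apply: bigmax_le; first exact: rhs0.
move=> r rB; rewrite mxE [delta in leRHS](_ : _ = 64 * (delta / 64)); last by field.
apply: (@final_coord_le _ _ _ X _ rs bs m0 l _ B (block_value Y B)) => //.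
- by rewrite l_le.
- by rewrite (block_value_ge0 prod rs BP) (block_value_le_lambda_star prod rs BP).
- exact: (optimal_on_block rs bs prod BP).
- by move=> mu; exact: (block_value_witness prod rs BP).
Qed.

(** The 5 is the fuel per phase, [64 ^ 2] comes from [eps = delta / 64], and 21 collects 1 for the
    initial calls, 15 for the search and 5 for rounding up [p]; the leading 4 converts [log2_bound]
    to [ln]. *)
Lemma calls_solver : (calls f (solver n m delta))%:R <=
  4 * (5 * 64 ^+ 2 + 21) * ((n + m)%:R / delta ^+ 2 * ln (maxn m 2)%:R) :> R.
Proof.
have /andP[d0 d1] := delta01; have := log2_bound_le R m.
set k := log2_bound m; set L := ln _ => kL.
have k1 : 1 <= k%:R :> R by rewrite ler1n.
have d2 : 1 <= (delta ^+ 2)^-1 by rewrite invf_ge1 ?exprn_gt0// exprn_ile1// ltW.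
have kd : k%:R <= k%:R / delta ^+ 2 by rewrite ler_peMr.
suff main : (calls f (solver n m delta))%:R <= (n + m)%:R * ((5 * 64 ^+ 2 + 21) * (k%:R / delta ^+ 2)).
  apply: le_trans main _.
  have -> : 4 * (5 * 64 ^+ 2 + 21) * ((n + m)%:R / delta ^+ 2 * L) = (n + m)%:R * ((5 * 64 ^+ 2 + 21) * (4 * L / delta ^+ 2)).
    by ring.
  have K0 : 0 <= 5 * 64 ^+ 2 + 21 :> R by rewrite addr_ge0// mulr_ge0// exprn_ge0.
  by rewrite ler_wpM2l// ler_wpM2l// ler_wpM2r// (le_trans ler01).
rewrite /solver calls_bind calls_collect size_enum_ord.
set x0 := result f (collect _ _).
case: ifPn => [_|Sneq0] /=.
  rewrite addn0; apply: (@le_trans _ _ ((n + m)%:R * 1)).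
    by rewrite mulr1 ler_nat leq_addr.
  have : 0 <= 64 ^+ 2 * (k%:R / delta ^+ 2) by rewrite mulr_ge0//; lra.
  by rewrite ler_wpM2l//; lra.
have nm : (0 < n + m)%N.
  by rewrite addn_gt0 (sum_rV_neq0 Sneq0) orbT.
rewrite calls_bind /= [X in (_ + (_ + X))%N]calls_bind /= addn0.
set l := result f _; set p := phase_count _ _.
have ss := calls_scale_search f k k ((\sum_r x0 0 r) / m%:R) nm.
(* The quotients contribute [2 * k], the successors another [k]. *)
have sum_le : (\sum_(i < k) (k %/ 2 ^ i).+1 <= 3 * k)%N.
  under eq_bigr do rewrite -addn1.
  rewrite big_split/= sum_nat_const card_ord muln1 (mulSn 2) addnC leq_add2l.
  exact: sum_div_expn2_le.
have fin : (calls f (phases n (delta / 64 / (32 * l)) (32 * l) p (phase_fuel n m p) 0)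
    <= 5 * (p * (n + m)))%N.
  exact: leq_trans (calls_phases_le _ _ _ _ _ _) (phase_fuel_le _ nm).
apply: (@le_trans _ _ (n + (5 * (3 * k * (n + m)) + 5 * (p * (n + m))))%:R).
  rewrite ler_nat leq_add2l leq_add//.
  by apply: leq_trans ss _; rewrite leq_mul2l leq_mul2r sum_le !orbT.
have p_le : p%:R <= 64 ^+ 2 * (k%:R / delta ^+ 2) + 1.
  apply: le_trans (phase_count_le _ _) _; first by rewrite divr_gt0.
  rewrite lerD2r le_eqVlt; apply/orP; left; apply/eqP.
  by rewrite -/k; field; rewrite gt_eqF.
apply: (@le_trans _ _ ((n + m)%:R * (1 + 15 * k%:R + 5 * p%:R))).
  have n_le : n%:R <= (n + m)%:R :> R by rewrite ler_nat leq_addr.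
  rewrite (natrD _ n) (natrD _ (5 * _)) !natrM.
  move: (n + m)%N n_le => N n_le; lra.
by rewrite ler_wpM2l//; lra.
Qed.

End Solver.

(* For m = 1 the factor log m would forbid every oracle call; it is read as
   log (max m 2), which is log m for all m >= 2. *)
Theorem theorem7 (R : realType) :
  exists (K : R) (alg : forall n m : nat, R -> oracle_algorithm R n m),
  forall (n m : nat) (X : 'I_n -> set 'rV[R]_m)
    (f : 'I_n -> price R m -> 'rV[R]_m)
    (P : {set {set 'I_m}}) (Y : 'I_n -> forall B : {set 'I_m}, set 'rV[R]_#|B|),
  resource_sharing X -> block_solver 1 X f -> product_structure X P Y ->
  forall delta : R, 0 < delta <= 1 ->
  let x := output f (alg n m delta) in
  [/\ minkowski_sum X x,
      forall B, B \in P ->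
        \big[Num.max/0]_(r in B) x 0 r <=
          minimum (minkowski_sum (fun C => Y C B)) (fun z => `|z|)
          + delta * lambda_star X
    & (oracle_calls f (alg n m delta))%:R <=
        K * ((n + m)%:R / delta ^+ 2 * ln (maxn m 2)%:R)].
Proof.
exists (4 * (5 * 64 ^+ 2 + 21)), (fun n m delta => algorithm_of (solver n m delta)).
move=> n m X f P Y rs bs prod delta delta01 /=.
rewrite output_algorithm_of oracle_calls_algorithm_of.
have [Xx x_le] := solver_spec rs bs delta01 prod.
by split=> //; exact: calls_solver.
Qed.
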